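(* Let $P(\lambda)=A_1\lambda+A_0$ be a linear quaternion matrix polynomial with $A_0,A_1\in M_n(\mathbb{H})$ and $A_1$ invertible. Suppose that one of the following holds: (a) $A_0$ and $A_1$ are unitary matrices; (b) $A_0$ and $A_1$ are diagonal matrices; (c) $A_0$ and $A_1$ are positive definite matrices. Then the block companion matrix $C_P=-A_1^{-1}A_0$ of $P(\lambda)$ is diagonalizable.
   Context: $\mathbb{H}$ is the set of real quaternions and $M_n(\mathbb{H})$ is the set of $n\times n$ matrices over $\mathbb{H}$. For $A\in M_n(\mathbb{H})$, $A^*$ is the conjugate transpose; $A$ is unitary if $AA^*=I=A^*A$; $A$ is Hermitian if $A^*=A$; $A$ is positive definite if $A$ is Hermitian and $x^*Ax>0$ for every nonzero $x\in\mathbb{H}^n$. A quaternion $\lambda_0$ is a right eigenvalue of $A$ if $Ax=x\lambda_0$ for some nonzero $x\in\mathbb{H}^n$. Every $A\in M_n(\mathbb{H})$ has exactly $n$ (counted with multiplicity) right eigenvalues that are complex numbers with nonnegative imaginary part; these are called the standard eigenvalues of $A$. Multiplicities are as follows: write $A=A_1'+A_2' j$ with $A_1',A_2'\in M_n(\mathbb{C})$ and let $\chi_A=\begin{bmatrix}A_1'&A_2'\\-\overline{A_2'}&\overline{A_1'}\end{bmatrix}\in M_{2n}(\mathbb{C})$; then $\lambda_1,\dots,\lambda_n$ (with nonnegative imaginary parts) are the standard eigenvalues of $A$ exactly when the eigenvalues of $\chi_A$, counted with algebraic multiplicity, are $\lambda_1,\dots,\lambda_n,\bar\lambda_1,\dots,\bar\lambda_n$.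 $A$ is diagonalizable if there is an invertible $S\in M_n(\mathbb{H})$ with $S^{-1}AS=\operatorname{diag}(\lambda_1,\dots,\lambda_n)$, where the $\lambda_i$ are the standard eigenvalues of $A$. *)

(* Defs.v *)
From HB Require Import structures.
From mathcomp Require Import all_boot all_order all_algebra.
From mathcomp Require Import ring reals complex.

Set Implicit Arguments.
Unset Strict Implicit.
Unset Printing Implicit Defensive.

Import Order.TTheory GRing.Theory Num.Theory.

Local Open Scope ring_scope.

(* [Quat a b c d] is a + b i + c j + d k. *)
Record quat (R : Type) := Quat { qre : R; qi : R; qj : R; qk : R }.

Definition tuple_of_quat (R : Type) (q : quat R) : R * R * R * R :=
  (qre q, qi q, qj q, qk q).

Definition quat_of_tuple (R : Type) (t : R * R * R * R) : quat R :=
  let: (a, b, c, d) := t in Quat a b c d.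

Lemma tuple_of_quatK (R : Type) :
  cancel (@tuple_of_quat R) (@quat_of_tuple R).
Proof. by case. Qed.

HB.instance Definition _ (R : choiceType) :=
  Choice.copy (quat R) (can_type (@tuple_of_quatK R)).

Definition addq (R : zmodType) (p q : quat R) : quat R :=
  Quat (qre p + qre q) (qi p + qi q) (qj p + qj q) (qk p + qk q).

Definition oppq (R : zmodType) (q : quat R) : quat R :=
  Quat (- qre q) (- qi q) (- qj q) (- qk q).

Lemma addqA (R : zmodType) : associative (@addq R).
Proof. by case=> ? ? ? ? [? ? ? ?] [? ? ? ?]; rewrite /addq /= !addrA. Qed.

Lemma addqC (R : zmodType) : commutative (@addq R).
Proof.
by case=> a b c d [a' b' c' d']; congr Quat => /=; rewrite addrC.
Qed.

Lemma add0q (R : zmodType) : left_id (Quat 0 0 0 0) (@addq R).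
Proof. by case=> a b c d; rewrite /addq /= !add0r. Qed.

Lemma addNq (R : zmodType) :
  left_inverse (Quat 0 0 0 0) (@oppq R) (@addq R).
Proof. by case=> a b c d; rewrite /addq /= !addNr. Qed.

HB.instance Definition _ (R : zmodType) :=
  GRing.isZmodule.Build (quat R) (@addqA R) (@addqC R) (@add0q R) (@addNq R).

Definition mulq (R : pzRingType) (p q : quat R) : quat R :=
  Quat (qre p * qre q - qi p * qi q - qj p * qj q - qk p * qk q)
       (qre p * qi q + qi p * qre q + qj p * qk q - qk p * qj q)
       (qre p * qj q - qi p * qk q + qj p * qre q + qk p * qi q)
       (qre p * qk q + qi p * qj q - qj p * qi q + qk p * qre q).

Lemma mulqA (R : comNzRingType) : associative (@mulq R).
Proof.
by case=> a b c d [a' b' c' d'] [x y z t]; congr Quat => /=; ring.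
Qed.

Lemma mul1q (R : comNzRingType) : left_id (Quat 1 0 0 0) (@mulq R).
Proof. by case=> a b c d; congr Quat => /=; ring. Qed.

Lemma mulq1 (R : comNzRingType) : right_id (Quat 1 0 0 0) (@mulq R).
Proof. by case=> a b c d; congr Quat => /=; ring. Qed.

Lemma mulqDl (R : comNzRingType) : left_distributive (@mulq R) (@addq R).
Proof.
by case=> a b c d [a' b' c' d'] [x y z t]; congr Quat => /=; ring.
Qed.

Lemma mulqDr (R : comNzRingType) : right_distributive (@mulq R) (@addq R).
Proof.
by case=> a b c d [a' b' c' d'] [x y z t]; congr Quat => /=; ring.
Qed.

Lemma oneq_neq0 (R : comNzRingType) : Quat 1 0 0 0 != 0 :> quat R.
Proof. by apply/eqP => -[] /eqP; rewrite oner_eq0. Qed.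

HB.instance Definition _ (R : comNzRingType) :=
  GRing.Zmodule_isNzRing.Build (quat R) (@mulqA R) (@mul1q R) (@mulq1 R)
    (@mulqDl R) (@mulqDr R) (@oneq_neq0 R).

Definition conjq (R : zmodType) (q : quat R) : quat R :=
  Quat (qre q) (- qi q) (- qj q) (- qk q).

Definition quat_of_real (R : zmodType) (a : R) : quat R := Quat a 0 0 0.

Definition quat_of_complex (R : zmodType) (z : R[i]) : quat R :=
  Quat (complex.Re z) (complex.Im z) 0 0.

(* Since i j = k, every quaternion is cpart1 q + cpart2 q * j. *)
Definition cpart1 (R : Type) (q : quat R) : R[i] := (qre q +i* qi q)%C.
Definition cpart2 (R : Type) (q : quat R) : R[i] := (qj q +i* qk q)%C.

Lemma quat_decomp (R : comNzRingType) (q : quat R) :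
  q = quat_of_complex (cpart1 q) + quat_of_complex (cpart2 q) * Quat 0 0 1 0.
Proof. by case: q => a b c d; congr Quat => /=; ring. Qed.

Definition adjq (R : zmodType) (m n : nat) (A : 'M[quat R]_(m, n)) :
  'M[quat R]_(n, m) := map_mx (@conjq R) A^T.

(* [invmx] and [unitmx] require a commutative ring, hence this relation. *)
Definition inverse_mx (R : comNzRingType) (n : nat) (A B : 'M[quat R]_n) :=
  A *m B = 1%:M /\ B *m A = 1%:M.

Definition unitaryq (R : comNzRingType) (n : nat) (A : 'M[quat R]_n) :=
  A *m adjq A = 1%:M /\ adjq A *m A = 1%:M.

Definition hermitianq (R : zmodType) (n : nat) (A : 'M[quat R]_n) :=
  adjq A = A.

(* x^* A x > 0 says that this quaternion is a positive real number. *)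
Definition posdefq (R : realType) (n : nat) (A : 'M[quat R]_n) :=
  hermitianq A /\
  forall x : 'cV[quat R]_n, x != 0 ->
    exists2 r : R, 0 < r & (adjq x *m A *m x) 0 0 = quat_of_real r.

(* A x = x l0 : the scalar acts on the right. *)
Definition right_eigenvalue (R : comNzRingType) (n : nat) (A : 'M[quat R]_n)
    (l0 : quat R) :=
  exists2 x : 'cV[quat R]_n, x != 0 & A *m x = x *m l0%:M.

Definition chi_mx (R : realType) (n : nat) (A : 'M[quat R]_n) :
    'M[R[i]]_(n + n) :=
  let A1 := map_mx (@cpart1 R) A in
  let A2 := map_mx (@cpart2 R) A in
  block_mx A1 A2 (- map_mx Num.conj A2) (map_mx Num.conj A1).

(* The roots of the characteristic polynomial of [chi_mx A] are counted with
   algebraic multiplicity, which determines the family [l] up to order. *)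
Definition standard_eigenvalues (R : realType) (n : nat) (A : 'M[quat R]_n)
    (l : 'I_n -> R[i]) :=
  (forall i, right_eigenvalue A (quat_of_complex (l i)) /\
             0 <= complex.Im (l i)) /\
  char_poly (chi_mx A) =
    \prod_(i < n) ('X - (l i)%:P) * \prod_(i < n) ('X - (Num.conj (l i))%:P).

Definition diagonalizableq (R : realType) (n : nat) (A : 'M[quat R]_n) :=
  exists l : 'I_n -> R[i], standard_eigenvalues A l /\
  exists S S' : 'M[quat R]_n, inverse_mx S S' /\
    S' *m A *m S = diag_mx (\row_(i < n) quat_of_complex (l i)).

(* Main.v *)
(** Over the quaternions every normal matrix is unitarily diagonalizable: a
    right eigenvector comes from a complex eigenvector of [chi_mx], a Householder
    reflection moves it to the first basis vector, normality kills the rest of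
    the first row, and one recurses on the remaining block.  Conjugating each
    diagonal entry by a unit quaternion makes it complex with nonnegative
    imaginary part.  In cases (a) and (b) the companion matrix is itself normal.
    In case (c) the spectral theorem gives [T] with [T^* A1 T = 1], and then
    [T^-1 (- A1^-1 A0) T = - T^* A0 T] is Hermitian. *)

Require Import Defs.
From HB Require Import structures.
From mathcomp Require Import all_boot all_order all_algebra.
From mathcomp Require Import ring reals complex.

Import Order.TTheory GRing.Theory Num.Theory.

Local Open Scope ring_scope.

Set Implicit Arguments.
Unset Strict Implicit.
Unset Printing Implicit Defensive.

(** * Arithmetic of a single quaternion: conjugation, complex parts, norm *)

Section Quaternions.
Variable R : realType.
Implicit Types (p q : quat R) (a b : R) (z : R[i]).

Lemma conjq_is_additive : zmod_morphism (@conjq R).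
Proof. by case=> ? ? ? ? [? ? ? ?]; congr Quat => /=; ring. Qed.

HB.instance Definition _ :=
  GRing.isZmodMorphism.Build (quat R) (quat R) (@conjq R) conjq_is_additive.

Lemma quat_of_real_is_additive : zmod_morphism (@quat_of_real R).
Proof. by move=> a b; congr Quat => /=; ring. Qed.

HB.instance Definition _ :=
  GRing.isZmodMorphism.Build R (quat R) (@quat_of_real R)
    quat_of_real_is_additive.

Lemma cpart1_is_additive : zmod_morphism (@cpart1 R).
Proof. by case=> ? ? ? ? [? ? ? ?]. Qed.

HB.instance Definition _ :=
  GRing.isZmodMorphism.Build (quat R) R[i] (@cpart1 R) cpart1_is_additive.

Lemma cpart2_is_additive : zmod_morphism (@cpart2 R).
Proof. by case=> ? ? ? ? [? ? ? ?]. Qed.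

HB.instance Definition _ :=
  GRing.isZmodMorphism.Build (quat R) R[i] (@cpart2 R) cpart2_is_additive.

Lemma conjqK : involutive (@conjq R).
Proof. by case=> a b c d; congr Quat => /=; ring. Qed.

Lemma conjqM p q : conjq (p * q) = conjq q * conjq p.
Proof. by case: p q => ? ? ? ? [? ? ? ?]; congr Quat => /=; ring. Qed.

Lemma conjq1 : conjq 1 = 1 :> quat R.
Proof. by congr Quat => /=; ring. Qed.

Lemma conjq_real a : conjq (quat_of_real a) = quat_of_real a.
Proof. by congr Quat => /=; ring. Qed.

Lemma quat_of_realM a b :
  quat_of_real (a * b) = quat_of_real a * quat_of_real b.
Proof. by congr Quat => /=; ring. Qed.

Lemma quat_of_realC a q : quat_of_real a * q = q * quat_of_real a.
Proof. by case: q => ? ? ? ?; congr Quat => /=; ring. Qed.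

Lemma quat_of_complexE z :
  (cpart1 (quat_of_complex z) = z) * (cpart2 (quat_of_complex z) = 0).
Proof. by split=> //; case: z. Qed.

Lemma cpart_inj p q : cpart1 p = cpart1 q -> cpart2 p = cpart2 q -> p = q.
Proof.
by case: p q => ? ? ? ? [? ? ? ?]; rewrite /cpart1 /cpart2 => -[-> ->] [-> ->].
Qed.

(** Expand [(p1 + p2 j) (q1 + q2 j)] with [j z = conj z j] for complex [z] and [j^2 = -1]; the next
    lemma collects the [j] part of the same product. *)
Lemma cpart1M p q :
  cpart1 (p * q) = cpart1 p * cpart1 q - cpart2 p * Num.conj (cpart2 q).
Proof. by case: p q => ? ? ? ? [? ? ? ?]; congr Complex => /=; ring. Qed.

Lemma cpart2M p q :
  cpart2 (p * q) = cpart1 p * cpart2 q + cpart2 p * Num.conj (cpart1 q).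
Proof. by case: p q => ? ? ? ? [? ? ? ?]; congr Complex => /=; ring. Qed.

Definition normsq q : R := qre q ^+ 2 + qi q ^+ 2 + qj q ^+ 2 + qk q ^+ 2.

Lemma mul_conjq q : q * conjq q = quat_of_real (normsq q).
Proof. by case: q => ? ? ? ?; rewrite /normsq; congr Quat => /=; ring. Qed.

Lemma conj_mulq q : conjq q * q = quat_of_real (normsq q).
Proof. by case: q => ? ? ? ?; rewrite /normsq; congr Quat => /=; ring. Qed.

Lemma normsq_ge0 q : 0 <= normsq q.
Proof. by rewrite /normsq !addr_ge0 ?sqr_ge0. Qed.

Lemma normsq_eq0 q : (normsq q == 0) = (q == 0).
Proof.
apply/idP/eqP => [|->]; last by rewrite /normsq /= expr0n !addr0.
case: q => a b c d; rewrite /normsq /=.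
rewrite !paddr_eq0 ?addr_ge0 ?sqr_ge0 // !sqrf_eq0.
by move=> /andP[/andP[/andP[/eqP-> /eqP->] /eqP->] /eqP->].
Qed.

Lemma normsqM p q : normsq (p * q) = normsq p * normsq q.
Proof. by case: p q => ? ? ? ? [? ? ? ?]; rewrite /normsq /=; ring. Qed.

Lemma normsq_real a : normsq (quat_of_real a) = a ^+ 2.
Proof. by rewrite /normsq /= expr0n !addr0. Qed.

(** Since [p * conjq p] is real, the normalised conjugate of [p] with a minus sign serves as [u].
    The sign of [a] is chosen for the reflection built later. *)
Lemma quat_phase p :
  exists2 u : quat R, normsq u = 1 &
  exists2 a, a <= 0 & p * u = quat_of_real a.
Proof.
have [->|p0] := eqVneq p 0.
  exists 1; first by rewrite /normsq /=; ring.
  by exists 0; rewrite // mul0r raddf0.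
have N0 : 0 < normsq p by rewrite lt_def normsq_eq0 p0 normsq_ge0.
set s := Num.sqrt (normsq p).
have s0 : 0 < s by rewrite sqrtr_gt0.
have s2 : s ^+ 2 = normsq p by rewrite sqr_sqrtr // ltW.
have conjN : normsq (conjq p) = normsq p by rewrite /normsq /= !sqrrN.
exists (conjq p * quat_of_real (- s^-1)).
  rewrite normsqM normsq_real conjN -s2 sqrrN exprVn divff //.
  by rewrite expf_neq0 ?gt_eqF.
exists (- s); first by rewrite oppr_le0 ltW.
rewrite mulrA mul_conjq -quat_of_realM -s2; congr quat_of_real.
by field; rewrite gt_eqF.
Qed.

End Quaternions.

(** * Quaternion matrices and their adjoints *)

Section QuaternionMatrices.
Variable R : realType.
Local Notation Q := (quat R).

(** Right multiplication by [q%:M] is the right action of scalars on column vectors, to be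
    distinguished from the left action [*:]. *)
Lemma mulmx_scalarE m n (A : 'M[Q]_(m, n)) (q : Q) i j :
  (A *m q%:M) i j = A i j * q.
Proof. by rewrite -diag_const_mx mul_mx_diag !mxE. Qed.

Lemma mulmx_scalarA m n (A : 'M[Q]_(m, n)) (p q : Q) :
  A *m p%:M *m q%:M = A *m (p * q)%:M.
Proof. by apply/matrixP=> i j; rewrite !mulmx_scalarE mulrA. Qed.

Lemma adjqE m n (A : 'M[Q]_(m, n)) i j : adjq A i j = conjq (A j i).
Proof. by rewrite !mxE. Qed.

Lemma adjqM m n k (A : 'M[Q]_(m, n)) (B : 'M[Q]_(n, k)) :
  adjq (A *m B) = adjq B *m adjq A.
Proof.
apply/matrixP=> i j; rewrite adjqE !mxE raddf_sum; apply: eq_bigr => l _.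
by rewrite !adjqE -conjqM.
Qed.

Lemma adjqK m n (A : 'M[Q]_(m, n)) : adjq (adjq A) = A.
Proof. by apply/matrixP=> i j; rewrite !adjqE conjqK. Qed.

Lemma adjqN m n (A : 'M[Q]_(m, n)) : adjq (- A) = - adjq A.
Proof. by rewrite /adjq raddfN map_mxN. Qed.

Lemma adjqB m n (A B : 'M[Q]_(m, n)) : adjq (A - B) = adjq A - adjq B.
Proof. by rewrite /adjq raddfB map_mxB. Qed.

Lemma adjq_diag n (d : 'rV[Q]_n) :
  adjq (diag_mx d) = diag_mx (map_mx (@conjq R) d).
Proof.
by apply/matrixP=> i j; rewrite !mxE raddfMn eq_sym; case: eqP => // ->.
Qed.

Lemma adjq_scalar n (q : Q) : adjq q%:M = (conjq q)%:M :> 'M_n.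
Proof. by apply/matrixP=> i j; rewrite !mxE raddfMn eq_sym. Qed.

Lemma adjq_delta m n (i : 'I_m) (j : 'I_n) :
  adjq (delta_mx i j) = delta_mx j i :> 'M[Q]_(n, m).
Proof.
apply/matrixP=> k l; rewrite adjqE !mxE andbC.
by case: (_ && _); rewrite ?conjq1 ?raddf0.
Qed.

Lemma adjq1 n : adjq 1%:M = 1%:M :> 'M[Q]_n.
Proof. by rewrite adjq_scalar conjq1. Qed.

Lemma adjq_block m1 m2 n1 n2 (A : 'M[Q]_(m1, n1)) (B : 'M_(m1, n2))
    (C : 'M_(m2, n1)) (D : 'M_(m2, n2)) :
  adjq (block_mx A B C D) = block_mx (adjq A) (adjq C) (adjq B) (adjq D).
Proof. by rewrite /adjq tr_block_mx map_block_mx. Qed.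

Lemma adjq0 m n : adjq 0 = 0 :> 'M[Q]_(m, n).
Proof. by rewrite /adjq trmx0 map_mx0. Qed.

Lemma adjq_mul_self n (x : 'cV[Q]_n) :
  adjq x *m x = (quat_of_real (\sum_i normsq (x i 0)))%:M.
Proof.
apply/matrixP=> i j; rewrite !ord1 !mxE eqxx mulr1n raddf_sum.
by apply: eq_bigr => k _; rewrite adjqE conj_mulq.
Qed.

Lemma sum_normsq_gt0 n (x : 'cV[Q]_n) :
  x != 0 -> 0 < \sum_i normsq (x i 0).
Proof.
move=> x0; rewrite lt_def sumr_ge0 ?andbT => [|i _]; last exact: normsq_ge0.
apply: contra x0 => /eqP /psumr_eq0P H; apply/eqP/matrixP => i j.
rewrite ord1 mxE; apply/eqP; rewrite -normsq_eq0 H // => k _.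
exact: normsq_ge0.
Qed.

(** * The complex representation [chi_mx] and right eigenvectors *)

Lemma map_cpart1M m n k (A : 'M[Q]_(m, n)) (B : 'M[Q]_(n, k)) :
  map_mx (@cpart1 R) (A *m B) =
    map_mx (@cpart1 R) A *m map_mx (@cpart1 R) B -
    map_mx (@cpart2 R) A *m map_mx Num.conj (map_mx (@cpart2 R) B).
Proof.
apply/matrixP=> i j; rewrite !mxE raddf_sum -sumrB; apply: eq_bigr => l _.
by rewrite !mxE; apply: cpart1M.
Qed.

Lemma map_cpart2M m n k (A : 'M[Q]_(m, n)) (B : 'M[Q]_(n, k)) :
  map_mx (@cpart2 R) (A *m B) =
    map_mx (@cpart1 R) A *m map_mx (@cpart2 R) B +
    map_mx (@cpart2 R) A *m map_mx Num.conj (map_mx (@cpart1 R) B).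
Proof.
apply/matrixP=> i j; rewrite !mxE raddf_sum -big_split; apply: eq_bigr => l _.
by rewrite !mxE; apply: cpart2M.
Qed.

Lemma map_mxK (T : Type) (f : T -> T) m n :
  involutive f -> involutive (@map_mx T T f m n).
Proof. by move=> fK A; apply/matrixP=> i j; rewrite !mxE. Qed.

(* Stated for an abstract involution [f], which unification never unfolds. *)
Lemma mulmx_block_conj (K : comNzRingType) (f : {rmorphism K -> K}) n
    (A1 A2 B1 B2 : 'M[K]_n) :
  involutive f ->
  let chi X Y := block_mx X Y (- map_mx f Y) (map_mx f X) in
  chi A1 A2 *m chi B1 B2 =
  chi (A1 *m B1 - A2 *m map_mx f B2) (A1 *m B2 + A2 *m map_mx f B1).
Proof.
move=> fK /=; rewrite mulmx_block map_mxB map_mxD !map_mxM !(map_mxK fK).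
rewrite !(mulNmx, mulmxN) opprD; congr block_mx; exact: addrC.
Qed.

(** Multiplicativity turns a similarity over the quaternions into one over the complex numbers. *)
Lemma chi_mxM n (A B : 'M[Q]_n) : chi_mx (A *m B) = chi_mx A *m chi_mx B.
Proof.
by rewrite /chi_mx map_cpart1M map_cpart2M mulmx_block_conj //; apply: conjCK.
Qed.

(** The [j] part of a complex matrix vanishes. The resulting diagonal is the list of roots
    prescribed by [standard_eigenvalues]. *)
Lemma chi_mx_diag n (d : 'rV[R[i]]_n) :
  chi_mx (diag_mx (map_mx (@quat_of_complex R) d)) =
  diag_mx (row_mx d (map_mx Num.conj d)).
Proof.
rewrite diag_mx_row /chi_mx; set D := diag_mx (map_mx _ _).
have -> : map_mx (@cpart1 R) D = diag_mx d.
  by apply/matrixP=> i j; rewrite !mxE raddfMn /= quat_of_complexE.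
have -> : map_mx (@cpart2 R) D = 0.
  by apply/matrixP=> i j; rewrite !mxE raddfMn /= quat_of_complexE mul0rn.
by rewrite map_mx0 oppr0 map_diag_mx.
Qed.

Lemma chi_mx1 n : chi_mx 1%:M = 1%:M :> 'M[R[i]]_(n + n).
Proof.
rewrite /chi_mx (scalar_mx_block _ _ 1).
have -> : map_mx (@cpart1 R) 1%:M = 1%:M :> 'M_n.
  by apply/matrixP=> i j; rewrite !mxE raddfMn.
have -> : map_mx (@cpart2 R) 1%:M = 0 :> 'M_n.
  by apply/matrixP=> i j; rewrite !mxE raddfMn mul0rn.
by rewrite map_mx0 oppr0 map_mx1.
Qed.

Lemma complex_right_eigenvector n (A : 'M[Q]_n.+1) :
  exists x : 'cV[Q]_n.+1, exists z : R[i],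
  [/\ x != 0, 0 <= complex.Im z & A *m x = x *m (quat_of_complex z)%:M].
Proof.
(* [eigenvalue] refers to row vectors, so the transpose is used to obtain a column eigenvector of
   [chi_mx A]. *)
have /closed_rootP [z zroot] : size (char_poly (chi_mx A)^T) != 1.
  by rewrite size_char_poly.
move: zroot; rewrite -eigenvalue_root_char => /eigenvalueP [w wE w0].
set v := w^T; pose v1 := usubmx v; pose v2 := dsubmx v.
have : chi_mx A *m v = z *: v.
  by rewrite -[LHS]trmxK trmx_mul trmxK wE linearZ.
rewrite -[v]vsubmxK -/v1 -/v2 /chi_mx mul_block_col scale_col_mx.
case/eq_col_mx => E1 E2.
(* The first block column of the representation of [x] should be [(v1, v2)], which forces
   [cpart1 x = v1] and [cpart2 x = - conj v2]. *)
pose x : 'cV[Q]_n.+1 := \col_i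
  (quat_of_complex (v1 i 0) -
   quat_of_complex (Num.conj (v2 i 0)) * Quat 0 0 1 0).
have x1 : map_mx (@cpart1 R) x = v1.
  apply/matrixP=> i j; rewrite ord1 !mxE raddfB /= cpart1M !quat_of_complexE.
  by rewrite (_ : cpart1 _ = 0) // mulr0 mul0r subrr subr0.
have x2 : map_mx (@cpart2 R) x = - map_mx Num.conj v2.
  apply/matrixP=> i j; rewrite ord1 !mxE raddfB /= cpart2M !quat_of_complexE.
  by rewrite (_ : cpart2 (Quat 0 0 1 0) = 1) // mulr1 mul0r sub0r addr0.
have Ax : A *m x = x *m (quat_of_complex z)%:M.
  apply/matrixP=> i j; apply: cpart_inj.
    transitivity (map_mx (@cpart1 R) (A *m x) i j); first by rewrite [RHS]mxE.
    rewrite map_cpart1M x1 x2 map_mxN (map_mxK (@conjCK _)) mulmxN opprK E1 -x1.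
    rewrite mulmx_scalarE !mxE cpart1M !quat_of_complexE rmorph0.
    by rewrite mulr0 subr0 mulrC.
  transitivity (map_mx (@cpart2 R) (A *m x) i j); first by rewrite [RHS]mxE.
  have -> : map_mx (@cpart2 R) (A *m x) = - map_mx Num.conj (z *: v2).
    rewrite -E2 map_mxD !map_mxM map_mxN !(map_mxK (@conjCK _)).
    rewrite map_cpart2M x1 x2.
    by rewrite opprD mulNmx opprK mulmxN addrC.
  rewrite map_mxZ -scalerN -x2 mulmx_scalarE !mxE cpart2M !quat_of_complexE.
  by rewrite mulr0 add0r mulrC.
have x0 : x != 0.
  apply: contra w0 => /eqP xE; rewrite -[w]trmxK -/v -[v]vsubmxK -/v1 -/v2.
  rewrite -x1 -[v2](map_mxK (@conjCK _)) -[map_mx _ v2]opprK -x2 xE.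
  rewrite !map_mx0 oppr0 map_mx0.
  by rewrite col_mx0 trmx0.
have [Imz|Imz] := leP 0 (complex.Im z); first by exists x, z.
(* If [Im z < 0], then [x j] is an eigenvector for [conj z], because [z j = j conj z]. *)
pose J : Q := Quat 0 0 1 0.
have zJ : quat_of_complex z * J = J * quat_of_complex (Num.conj z).
  by case: z {wE E1 E2 Ax Imz} => a b; congr Quat => /=; ring.
have JJ : J * (- J) = 1 by congr Quat => /=; ring.
exists (x *m J%:M), (Num.conj z); split.
- apply: contra x0 => /eqP xJ; rewrite -[x]mulmx1 -JJ scalar_mxM mulmxA xJ.
  by rewrite mul0mx.
- by case: z {wE E1 E2 Ax zJ} Imz => a b /=; rewrite oppr_ge0; apply: ltW.
- by rewrite mulmxA Ax !mulmx_scalarA zJ.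
Qed.

End QuaternionMatrices.

Lemma mulmx_cancel_inner (K : pzRingType) n (A B C D : 'M[K]_n) :
  B *m C = 1%:M -> A *m D = 1%:M -> A *m B *m (C *m D) = 1%:M.
Proof. by move=> BC AD; rewrite mulmxA -[A *m B *m C]mulmxA BC mulmx1. Qed.

Lemma mulmx_conj (K : pzRingType) n (U V A B : 'M[K]_n) : U *m V = 1%:M ->
  V *m A *m U *m (V *m B *m U) = V *m (A *m B) *m U.
Proof.
by move=> UV; rewrite !mulmxA -[V *m A *m U *m V]mulmxA UV mulmx1.
Qed.

Lemma mulmx_conj_conj (K : pzRingType) n (U V W X A : 'M[K]_n) :
  X *m V *m A *m (U *m W) = X *m (V *m A *m U) *m W.
Proof. by rewrite !mulmxA. Qed.

(** * Unit eigenvectors, reflections and the standard form of a quaternion *)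

Section QuaternionSpectral.
Variable R : realType.
Local Notation Q := (quat R).

Lemma real_scalar_mxB n (a b : R) :
  (quat_of_real a)%:M - (quat_of_real b)%:M =
  (quat_of_real (a - b))%:M :> 'M[Q]_n.
Proof. by rewrite -raddfB -raddfB. Qed.

Lemma real_scalar_mxM n (a b : R) :
  (quat_of_real a)%:M *m (quat_of_real b)%:M =
  (quat_of_real (a * b))%:M :> 'M[Q]_n.
Proof. by rewrite -scalar_mxM -quat_of_realM. Qed.

(** From [A x = x z] follows [A (x t) = (x t) (t^-1 z t)], so an eigenvector may be scaled on the
    right by any nonzero [t]. One such [t] both normalises [x] and makes its first entry real and
    nonpositive, at the price of an eigenvalue [q] that may no longer be complex. *)
Lemma unit_right_eigenvector n (A : 'M[Q]_n.+1) :
  exists x : 'cV[Q]_n.+1, exists q : Q, exists a : R,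
  [/\ adjq x *m x = 1%:M, a <= 0, x 0 0 = quat_of_real a &
      A *m x = x *m q%:M].
Proof.
have [x [z [x0 _ Ax]]] := complex_right_eigenvector A.
have [u u1 [b b0 xu]] := quat_phase (x 0 0).
have := sum_normsq_gt0 x0; set N := \sum_i _ => N0.
pose s := Num.sqrt N.
have s0 : 0 < s by rewrite sqrtr_gt0.
have s2 : s ^+ 2 = N by rewrite sqr_sqrtr // ltW.
pose t := u * quat_of_real s^-1; pose t' := quat_of_real s * conjq u.
have tt' : t * t' = 1.
  rewrite /t /t' mulrA -[u * _ * _]mulrA -quat_of_realM mulVf ?gt_eqF //.
  by rewrite mulr1 mul_conjq u1.
exists (x *m t%:M), (t' * quat_of_complex z * t), (b * s^-1); split.
- rewrite adjqM adjq_scalar mulmxA -[_ *m adjq x *m x]mulmxA adjq_mul_self -/N.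
  rewrite -!scalar_mxM -quat_of_realC -mulrA conj_mulq -quat_of_realM.
  by rewrite normsqM u1 normsq_real mul1r exprVn s2 divff ?gt_eqF.
- by rewrite mulr_le0_ge0 // invr_ge0 ltW.
- by rewrite mulmx_scalarE mulrA xu quat_of_realM.
- rewrite mulmxA Ax [LHS]mulmx_scalarA [RHS]mulmx_scalarA; congr (_ *m _%:M).
  by rewrite -[t' * _ * t]mulrA [RHS]mulrA tt' mul1r.
Qed.

(* The reflection [1 - w w^*] with [w] proportional to [x - e], where [e] is
   the first basis vector; the first entry of [x] has to be real, and taking it
   nonpositive keeps [x - e] away from 0. *)
Lemma householder n (x : 'cV[Q]_n.+1) (a : R) :
  adjq x *m x = 1%:M -> a <= 0 -> x 0 0 = quat_of_real a ->
  exists H : 'M[Q]_n.+1,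
  [/\ adjq H = H, H *m H = 1%:M & H *m delta_mx 0 0 = x].
Proof.
move=> xx a0 xa; pose e : 'cV[Q]_n.+1 := delta_mx 0 0.
have a1 : 0 < 1 - a by rewrite subr_gt0 (le_lt_trans a0).
(* The squared norm of [x - e] is [2 (1 - a)]; this scaling gives [w^* w = 2], as a reflection
   [1 - w w^*] requires. *)
pose s := Num.sqrt (1 - a)^-1.
have s2 : s * s = (1 - a)^-1 by rewrite -expr2 sqr_sqrtr // invr_ge0 ltW.
have adj_e : adjq e = delta_mx 0 0 by apply: adjq_delta.
have ee : adjq e *m e = 1%:M.
  rewrite adj_e -rowE; apply/matrixP=> i j.
  by rewrite !mxE !ord1 eqxx.
have ex : adjq e *m x = (quat_of_real a)%:M.
  rewrite adj_e -rowE; apply/matrixP=> i j.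
  by rewrite !mxE !ord1 eqxx.
have xe : adjq x *m e = (quat_of_real a)%:M.
  by rewrite -[LHS]adjqK adjqM adjqK ex adjq_scalar conjq_real.
pose w := (x - e) *m (quat_of_real s)%:M.
have adj_w : adjq w = (quat_of_real s)%:M *m (adjq x - adjq e).
  by rewrite adjqM adjqB adjq_scalar conjq_real.
have one_real : 1%:M = (quat_of_real 1)%:M :> 'M[Q]_1 by [].
have we : adjq w *m e = (quat_of_real (s * (a - 1)))%:M.
  rewrite adj_w -mulmxA mulmxBl xe ee one_real real_scalar_mxB.
  exact: real_scalar_mxM.
have ww : adjq w *m w = (quat_of_real 2)%:M.
  rewrite adj_w mulmxA -[_ *m _ *m (x - e)]mulmxA mulmxBl !mulmxBr.
  rewrite xx xe ex ee one_real !(real_scalar_mxM, real_scalar_mxB).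
  congr ((quat_of_real _)%:M).
  transitivity (2 * (s * s) * (1 - a)); first by ring.
  by rewrite s2 mulfVK ?gt_eqF.
exists (1%:M - w *m adjq w); split.
- by rewrite adjqB adjq1 adjqM adjqK.
- have two : (quat_of_real 2)%:M = 1%:M + 1%:M :> 'M[Q]_1.
    by rewrite -raddfD; congr (_%:M); congr Quat; rewrite /= ?addr0.
  have PP : w *m adjq w *m (w *m adjq w) = w *m adjq w + w *m adjq w.
    rewrite mulmxA -[w *m _ *m w]mulmxA ww two.
    by rewrite mulmxDr mulmxDl mulmx1.
  move: (w *m adjq w) PP => P PP; rewrite mulmxBr mulmx1 mulmxBl mul1mx PP.
  have -> : P - (P + P) = - P by rewrite opprD addrA subrr sub0r.
  by rewrite opprK subrK.
(* Here [w (w^* e) = (x - e) s^2 (a - 1) = - (x - e)], so [e] is moved to [e + (x - e)]. *)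
- rewrite mulmxBl mul1mx -[w *m _ *m _]mulmxA we mulmx_scalarA -quat_of_realM.
  rewrite mulrA s2 -[a - 1]opprB mulrN mulVf ?gt_eqF //.
  have -> : (quat_of_real (- 1))%:M = - 1%:M :> 'M[Q]_1
    by rewrite -raddfN; congr (_%:M); congr Quat; rewrite /= oppr0.
  by rewrite mulmxN mulmx1 opprK addrC subrK.
Qed.

(** Viewed as a 1 by 1 matrix, [q] has an eigenvector [p] with [q p = p z]; normalising [p] gives
    [u]. *)
Lemma quat_standard_form (q : Q) :
  exists2 u : Q, normsq u = 1 &
  exists2 z : R[i], 0 <= complex.Im z & conjq u * q * u = quat_of_complex z.
Proof.
have [x [z [x0 Imz qx]]] := complex_right_eigenvector (q%:M : 'M_1).
pose p := x 0 0.
have p0 : 0 < normsq p.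
  rewrite lt_def normsq_ge0 normsq_eq0 andbT; apply: contra x0 => /eqP p0.
  by apply/eqP/matrixP=> i j; rewrite !ord1 mxE.
have {qx} qp : q * p = p * quat_of_complex z.
  move/matrixP/(_ 0 0): qx; rewrite mulmx_scalarE => <-.
  by rewrite mul_scalar_mx mxE.
pose s := Num.sqrt (normsq p).
have s0 : 0 < s by rewrite sqrtr_gt0.
have s2 : s ^+ 2 = normsq p by rewrite sqr_sqrtr // ltW.
have u1 : normsq (p * quat_of_real s^-1) = 1.
  by rewrite normsqM normsq_real exprVn s2 divff // gt_eqF.
exists (p * quat_of_real s^-1) => //; exists z => //.
rewrite -mulrA [q * _]mulrA qp.
rewrite -[p * _ * _]mulrA -(quat_of_realC _ (quat_of_complex z)).
by rewrite [p * (_ * _)]mulrA mulrA conj_mulq u1 mul1r.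
Qed.

(** * Normal matrices and their unitary diagonalization *)

Definition normalq n (A : 'M[Q]_n) := A *m adjq A = adjq A *m A.

Lemma unitaryq_normal n (A : 'M[Q]_n) : unitaryq A -> normalq A.
Proof. by case=> AA' A'A; rewrite /normalq AA' A'A. Qed.

Lemma hermitianq_normal n (A : 'M[Q]_n) : hermitianq A -> normalq A.
Proof. by rewrite /normalq => ->. Qed.

(** Although quaternions do not commute, each one commutes with its conjugate. *)
Lemma diag_normalq n (d : 'rV[Q]_n) : normalq (diag_mx d).
Proof.
rewrite /normalq adjq_diag !mulmx_diag; congr diag_mx.
by apply/rowP=> i; rewrite !mxE mul_conjq conj_mulq.
Qed.

Lemma unitaryqM n (A B : 'M[Q]_n) :
  unitaryq A -> unitaryq B -> unitaryq (A *m B).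
Proof.
move=> [AA' A'A] [BB' B'B]; split; rewrite adjqM.
  exact: mulmx_cancel_inner BB' AA'.
exact: mulmx_cancel_inner A'A B'B.
Qed.

Lemma unitaryqV n (A : 'M[Q]_n) : unitaryq A -> unitaryq (adjq A).
Proof. by case=> AA' A'A; split; rewrite adjqK. Qed.

Lemma unitaryqN n (A : 'M[Q]_n) : unitaryq A -> unitaryq (- A).
Proof. by case=> AA' A'A; split; rewrite adjqN mulNmx mulmxN opprK. Qed.

Lemma normalqN n (A : 'M[Q]_n) : normalq A -> normalq (- A).
Proof. by rewrite /normalq adjqN !mulNmx !mulmxN => ->. Qed.

Lemma normalqJ n (U A : 'M[Q]_n) :
  unitaryq U -> normalq A -> normalq (adjq U *m A *m U).
Proof.
move=> [UU' _] nA.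
have adjJ : adjq (adjq U *m A *m U) = adjq U *m adjq A *m U.
  by rewrite adjqM adjqM adjqK [LHS]mulmxA.
rewrite /normalq adjJ; transitivity (adjq U *m (A *m adjq A) *m U).
  exact: mulmx_conj.
move: nA; rewrite /normalq => ->; apply: esym; exact: mulmx_conj.
Qed.

(** Comparing upper left blocks gives [|q|^2 + r r^* = |q|^2], so [r r^* = 0] and [r = 0] by
    positivity of the norm. The lower right blocks then give normality of [B]. *)
Lemma normalq_block_triangular n (q : Q) (r : 'M[Q]_(1, n)) (B : 'M[Q]_n) :
  normalq (block_mx q%:M r 0 B : 'M_(1 + n)) -> r = 0 /\ normalq B.
Proof.
rewrite /normalq adjq_block !mulmx_block adjq0 adjq_scalar.
rewrite !(mul0mx, mulmx0, addr0, add0r) -!scalar_mxM mul_conjq conj_mulq.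
case/eq_block_mx => rr _ _ BB.
have {}rr : r *m adjq r = 0.
  by apply: (addrI (quat_of_real (normsq q))%:M); rewrite addr0.
have r0 : r = 0.
  apply/eqP; apply: contraT => r_neq0.
  have : adjq r != 0.
    by apply: contra r_neq0 => /eqP r0; rewrite -[r]adjqK r0 adjq0.
  move/sum_normsq_gt0; move: rr; rewrite -{1}[r]adjqK adjq_mul_self.
  move=> /matrixP /(_ 0 0); rewrite !mxE eqxx mulr1n => -[->].
  by rewrite ltxx.
by split=> //; move: BB; rewrite r0 adjq0 mul0mx add0r.
Qed.

Lemma normalq_spectral n (A : 'M[Q]_n) : normalq A ->
  exists U : 'M[Q]_n, exists l : 'rV[R[i]]_n,
  [/\ unitaryq U, forall i, 0 <= complex.Im (l 0 i) &
      adjq U *m A *m U = diag_mx (map_mx (@quat_of_complex R) l)].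
Proof.
elim: n A => [|n IHn] A nA.
  exists 1%:M, 0; split; last by apply/matrixP=> -[].
    by split; apply/matrixP=> -[].
  by case.
have [x [q [a [xx a0 xa Ax]]]] := unit_right_eigenvector A.
have [H [adjH HH He]] := householder xx a0 xa.
have uH : unitaryq H by split; rewrite adjH.
have [B BD] : exists B : 'M[Q]_n.+1, B = adjq H *m A *m H by eexists.
have nB : normalq B by rewrite BD; apply: normalqJ.
(* [H] sends the first basis vector to the eigenvector [x] and, being an involution, sends [x]
   back. *)
have Be : B *m delta_mx 0 0 = delta_mx 0 0 *m q%:M :> 'cV_n.+1.
  rewrite BD -mulmxA He -mulmxA Ax adjH mulmxA -{1}He mulmxA HH.
  by rewrite mul1mx.
have BE i : B i 0 = (i == 0)%:R * q.
  move/matrixP/(_ i 0): Be; rewrite -colE mxE mulmx_scalarE => ->.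
  by rewrite mxE eqxx andbT.
pose r := ursubmx (B : 'M_(1 + n)); pose B' := drsubmx (B : 'M_(1 + n)).
have lshift0 : lshift n (0 : 'I_1) = 0 :> 'I_n.+1 by apply: val_inj.
have Bblock : B = block_mx q%:M r 0 B'.
  have <- : ulsubmx (B : 'M_(1 + n)) = q%:M.
    by apply/matrixP=> i j; rewrite !mxE !ord1 lshift0 BE mul1r.
  have <- : dlsubmx (B : 'M_(1 + n)) = 0.
    by apply/matrixP=> i j; rewrite !mxE !ord1 lshift0 BE mul0r.
  by rewrite [RHS]submxK.
rewrite Bblock in nB; have [r0 nB'] := normalq_block_triangular nB.
have [V [l [uV Iml VBV]]] := IHn _ nB'.
(* The corner [q] is an arbitrary quaternion; conjugation by [u] makes it a standard eigenvalue,
   while [V] treats the remaining block. *)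
have [u u1 [z Imz uqu]] := quat_standard_form q.
pose W : 'M[Q]_(1 + n) := block_mx u%:M 0 0 V.
have uW : unitaryq W.
  case: uV => VV' V'V; split; rewrite adjq_block mulmx_block !adjq0 adjq_scalar.
    rewrite !mul0mx !mulmx0 !addr0 add0r VV' -scalar_mxM mul_conjq u1.
    by rewrite -scalar_mx_block.
  rewrite !mul0mx !mulmx0 !addr0 add0r V'V -scalar_mxM conj_mulq u1.
  by rewrite -scalar_mx_block.
exists (H *m W), (row_mx z%:M l : 'rV_(1 + n)); split.
- exact: unitaryqM.
- move=> i; rewrite mxE; case: splitP => j _; last exact: Iml.
  by rewrite !ord1 mxE eqxx.
- have -> : adjq (H *m W) *m A *m (H *m W) = adjq W *m B *m W.
    by rewrite adjqM BD; apply: mulmx_conj_conj.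
  rewrite Bblock r0.
  transitivity (adjq W *m (block_mx q%:M 0 0 B' : 'M_(1 + n)) *m W).
    by [].
  rewrite /W adjq_block !mulmx_block !adjq0 adjq_scalar.
  rewrite !(mul0mx, mulmx0, addr0, add0r) VBV -!scalar_mxM uqu.
  have z11 :
      map_mx (@quat_of_complex R) z%:M = const_mx (quat_of_complex z) :> 'rV_1.
    by apply/rowP=> i; rewrite !ord1 !mxE eqxx.
  rewrite -diag_const_mx -z11 -diag_mx_row; congr diag_mx.
  by apply/rowP=> i; rewrite !mxE; case: (@split 1 n i) => j; rewrite !mxE.
Qed.

End QuaternionSpectral.

(** * Similarity and diagonalizability *)

Lemma char_poly_similar (K : comNzRingType) n (S S' A : 'M[K]_n) :
  S' *m S = 1%:M -> char_poly (S' *m A *m S) = char_poly A.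
Proof.
move=> S'S; rewrite /char_poly /char_poly_mx.
have C_mul (X Y : 'M[K]_n) :
    map_mx polyC (X *m Y) = map_mx polyC X *m map_mx polyC Y.
  exact: map_mxM.
have CS : map_mx polyC S' *m map_mx polyC S = 1%:M.
  by rewrite -C_mul S'S map_mx1.
(* The scalar matrix ['X%:M] is unchanged by the conjugation, so the whole characteristic matrix is
   conjugated and the determinants of [S'] and [S] cancel. *)
have -> : 'X%:M - map_mx polyC (S' *m A *m S) =
    map_mx polyC S' *m ('X%:M - map_mx polyC A) *m map_mx polyC S.
  rewrite mulmxBr mulmxBl !C_mul; congr (_ - _).
  by rewrite scalar_mxC -mulmxA CS mulmx1.
by rewrite !det_mulmx mulrAC -det_mulmx CS det1 mul1r.
Qed.

Section Diagonalization.
Variable R : realType.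
Local Notation Q := (quat R).

(** The diagonal entries are automatically the standard eigenvalues: the columns of [S] are
    eigenvectors, and applying [chi_mx] to the similarity yields the characteristic polynomial. *)
Lemma diagonalizableq_similar n (A S S' : 'M[Q]_n) (l : 'rV[R[i]]_n) :
  inverse_mx S S' -> (forall i, 0 <= complex.Im (l 0 i)) ->
  S' *m A *m S = diag_mx (map_mx (@quat_of_complex R) l) ->
  diagonalizableq A.
Proof.
move=> [SS' S'S] Iml SAS; exists (l 0); split; last first.
  exists S, S'; split=> //; rewrite SAS; congr diag_mx.
  by apply/rowP=> i; rewrite !mxE.
split=> [i|].
  split; last exact: Iml.
  have AS : A *m S = S *m diag_mx (map_mx (@quat_of_complex R) l).
    by rewrite -SAS !mulmxA SS' mul1mx.
  exists (col i S).
    apply/eqP=> Si0; have := congr1 (mulmx S') Si0.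
    rewrite colE mulmxA S'S mul1mx mulmx0 => /matrixP /(_ i 0).
    by rewrite !mxE !eqxx; apply/eqP/oner_neq0.
  apply/matrixP=> j k; rewrite mulmx_scalarE colE mulmxA AS -colE mul_mx_diag.
  by rewrite -colE !mxE.
have chiS : chi_mx S' *m chi_mx S = 1%:M by rewrite -chi_mxM S'S chi_mx1.
rewrite -(char_poly_similar (chi_mx A) chiS) -!chi_mxM SAS chi_mx_diag.
rewrite char_poly_trig ?diag_mx_is_trig // big_split_ord /=.
congr (_ * _); apply: eq_bigr => i _; rewrite !mxE eqxx mulr1n.
  by rewrite (unsplitK (inl i)).
by rewrite (unsplitK (inr i)) mxE.
Qed.

Lemma normalq_similar_diagonalizable n (A S S' : 'M[Q]_n) :
  inverse_mx S S' -> normalq (S' *m A *m S) -> diagonalizableq A.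
Proof.
move=> [SS' S'S] /normalq_spectral [U [l [[UU' U'U] Iml UAU]]].
apply: (@diagonalizableq_similar _ _ (S *m U) (adjq U *m S') l) => //.
  split; first exact: mulmx_cancel_inner UU' SS'.
  exact: mulmx_cancel_inner S'S U'U.
by rewrite -UAU; apply: mulmx_conj_conj.
Qed.

Lemma normalq_diagonalizable n (A : 'M[Q]_n) : normalq A -> diagonalizableq A.
Proof.
move=> nA; apply: (@normalq_similar_diagonalizable _ _ 1%:M 1%:M).
  by split; rewrite mul1mx.
by rewrite mul1mx mulmx1.
Qed.

(** With [U^* A U] diagonal and its entries [r i] positive, [T] is [U] times the diagonal matrix of
    the [1 / sqrt (r i)]. *)
Lemma posdefq_congruent1 n (A : 'M[Q]_n) : posdefq A ->
  exists T T' : 'M[Q]_n, inverse_mx T T' /\ adjq T *m A *m T = 1%:M.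
Proof.
move=> [/hermitianq_normal /normalq_spectral [U [l [[UU' U'U] _ UAU]]] Apos].
pose r i := complex.Re (l 0 i).
(* The [i]-th diagonal entry is the form [x^* A x] at the [i]-th column of [U], hence real and
   positive. *)
have r_gt0 i : 0 < r i /\ quat_of_complex (l 0 i) = quat_of_real (r i).
  have Ui0 : col i U != 0.
    apply/eqP=> Ui0; have := congr1 (mulmx (adjq U)) Ui0.
    rewrite colE mulmxA U'U mul1mx mulmx0 => /matrixP /(_ i 0).
    by rewrite !mxE !eqxx; apply/eqP/oner_neq0.
  have [t t0] := Apos _ Ui0.
  have -> : adjq (col i U) *m A *m col i U =
      delta_mx 0 i *m diag_mx (map_mx (@quat_of_complex R) l) *m delta_mx i 0.
    by rewrite -UAU colE adjqM adjq_delta !mulmxA.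
  rewrite -rowE -colE !mxE eqxx mulr1n /r => -[rt it].
  by rewrite rt; split=> //; rewrite /quat_of_complex rt it.
pose s i := Num.sqrt (r i).
have s_gt0 i : 0 < s i by rewrite sqrtr_gt0; case: (r_gt0 i).
pose D : 'M[Q]_n := diag_mx (\row_i quat_of_real (s i)^-1).
pose D' : 'M[Q]_n := diag_mx (\row_i quat_of_real (s i)).
have diag1 (d e : 'rV[Q]_n) :
    (forall i, d 0 i * e 0 i = 1) -> diag_mx d *m diag_mx e = 1%:M.
  move=> de; rewrite mulmx_diag -diag_const_mx; congr diag_mx.
  by apply/rowP=> i; rewrite !mxE de.
have DD' : D *m D' = 1%:M.
  by apply: diag1 => i; rewrite !mxE -quat_of_realM mulVf // gt_eqF.
have D'D : D' *m D = 1%:M.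
  by apply: diag1 => i; rewrite !mxE -quat_of_realM mulfV // gt_eqF.
have adjD : adjq D = D.
  rewrite adjq_diag; congr diag_mx; apply/rowP=> i.
  by rewrite !mxE conjq_real.
exists (U *m D), (D' *m adjq U); split.
  split; first exact: mulmx_cancel_inner DD' UU'.
  exact: mulmx_cancel_inner U'U D'D.
rewrite adjqM mulmx_conj_conj UAU adjD /D mulmx_diag.
apply: diag1 => i; rewrite !mxE; have [_ ->] := r_gt0 i.
rewrite -!quat_of_realM -[r i]sqr_sqrtr ?ltW ?(r_gt0 i).1 // -/(s i).
rewrite (_ : _ * _ = 1) //.
by field; rewrite gt_eqF.
Qed.

Lemma inverse_mx_unitary n (A B : 'M[Q]_n) :
  inverse_mx A B -> unitaryq A -> B = adjq A.
Proof.
by move=> [_ BA] [AA' _]; rewrite -[LHS]mulmx1 -AA' mulmxA BA mul1mx.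
Qed.

(** Off the diagonal [B i j * d j = 0], while [d j * B j j = 1]; multiplying the former on the right
    by [B j j] gives [B i j = 0]. *)
Lemma inverse_diag_mx n (d : 'rV[Q]_n) (B : 'M[Q]_n) :
  inverse_mx (diag_mx d) B -> exists e, B = diag_mx e.
Proof.
move=> [/matrixP dB /matrixP Bd]; exists (\row_i B i i).
apply/matrixP=> i j; rewrite !mxE; have [->|ij] := eqVneq i j.
  by rewrite mulr1n.
have /= := Bd i j; rewrite mul_mx_diag !mxE (negPf ij) mulr0n => Bij.
have := dB j j; rewrite mul_diag_mx !mxE eqxx mulr1n => dBjj.
by rewrite -[B i j]mulr1 -dBjj mulrA Bij mul0r.
Qed.

End Diagonalization.

Unset Implicit Arguments.

Theorem theorem3p9 (R : realType) (n : nat) (A0 A1 A1inv : 'M[quat R]_n)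
    (hA1 : inverse_mx A1 A1inv)
    (hcase : (unitaryq A0 /\ unitaryq A1) \/
             (is_diag_mx A0 /\ is_diag_mx A1) \/
             (posdefq A0 /\ posdefq A1)) :
  diagonalizableq (- (A1inv *m A0)).
Proof.
case: hcase => [[u0 u1]|[[/diag_mxP [d0 E0] /diag_mxP [d1 E1]]|[[h0 _] p1]]].
- apply/normalq_diagonalizable/unitaryq_normal/unitaryqN.
  rewrite (inverse_mx_unitary hA1 u1).
  by apply: unitaryqM => //; apply: unitaryqV.
- rewrite E1 in hA1; have [e ->] := inverse_diag_mx hA1.
  apply/normalq_diagonalizable/normalqN.
  by rewrite E0 mulmx_diag; apply: diag_normalq.
have [T [T' [[TT' T'T] TAT]]] := posdefq_congruent1 p1.
apply: (normalq_similar_diagonalizable (conj TT' T'T)).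
(* Multiply [T^* A1 T = 1] on the right by [T^-1 A1^-1]. *)
have T'A1inv : T' *m A1inv = adjq T.
  case: hA1 => A1A1inv _.
  have : adjq T *m A1 *m T *m (T' *m A1inv) = adjq T.
    rewrite mulmxA -[_ *m T *m T']mulmxA TT' mulmx1.
    by rewrite -mulmxA A1A1inv mulmx1.
  by rewrite TAT mul1mx.
apply: hermitianq_normal.
rewrite /hermitianq mulmxN mulNmx adjqN mulmxA T'A1inv adjqM adjqM adjqK h0.
by rewrite mulmxA.
Qed.
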